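(* Let $n\ge 1$, $m\ge 1$, and let $Y=f(X,U)$ and $X=g(Z,U)$, where $X\in\mathbf{X}$ and $Z\in\mathbf{Z}$ for bounded rectangles $\mathbf{X}\subset\mathbb{R}^n$ and $\mathbf{Z}\subset\mathbb{R}^m$, $f(x,u)$ is smooth in $x$, and each component of $g(z,u)=(g_1(z,u),\dots,g_n(z,u))$ is smooth in $z$. Suppose that (i* ) $Z$ is independent of $U$; (ii* ) for all $i\in\{1,\dots,m\}$ and $j\in\{1,\dots,n\}$ and every $z\in\mathbf{Z}$, $\partial Y/\partial X_j$ and $\partial X_j/\partial Z_i$ are uncorrelated conditional on $Z=z$; (iii* ) $\operatorname{rank}(a(z))\ge n$ for every $z\in\mathbf{Z}$. Then $\phi(z)=E\left(\frac{\partial Y}{\partial X}\,\middle|\,Z=z\right)\in\mathbb{R}^n$ is identifiable via the equation $$a(z)\,\phi(z)=b(z);$$ that is, for every $z\in\mathbf{Z}$, $\phi(z)$ satisfies this linear system and is its unique solution in $\mathbb{R}^n$.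
   Context: All random variables are defined on a probability space $(\Omega,\mathcal{A},P)$. $Y$ is real-valued. $U$ is a random element of an arbitrary measurable space $\mathcal{U}$ (all other variables, besides $X$ and $Z$, that may affect $Y$ and $X$), and no restriction is placed on its distribution. $f:\mathbf{X}\times\mathcal{U}\to\mathbb{R}$ and $g:\mathbf{Z}\times\mathcal{U}\to\mathbf{X}$ are measurable; the rectangles $\mathbf X,\mathbf Z$ (products of bounded intervals) are nondegenerate, with one-sided derivatives at any boundary points they contain. ''Smooth in $x$'' means that $f(x,u)$ has first and second order derivatives in $x$ and that $f$ and these derivatives are uniformly bounded (over all $x$ and $u$); ''smooth in $z$'' for each $g_j(z,u)$ means the same with respect to $z$. Notation, for $i=1,\dots,m$ and $j=1,\dots,n$: - $h_j(x,u)=\frac{\partial f}{\partial x_j}(x,u)$ and $k_{ij}(z,u)=\frac{\partial g_j}{\partial z_i}(z,u)$. - $\partial Y/\partial X_j$ denotes the random variable $h_j(X,U)$; $\frac{\partial Y}{\partial X}$ denotes the random vector $(h_1(X,U),\dots,h_n(X,U))$; $\partial X_j/\partial Z_i$ denotes the random variable $k_{ij}(Z,U)$. - $b(z)\in\mathbb{R}^m$ has components $b_i(z)=\frac{\partial}{\partial z_i}E(Y\mid Z=z)$, and $a(z)\in\mathbb{R}^{m\times n}$ has entries $a_{ij}(z)=\frac{\partial}{\partial z_i}E(X_j\mid Z=z)$. - $B$ and $C$ are uncorrelated conditional on $Z=z$ if $E(BC\mid Z=z)=E(B\mid Z=z)\,E(C\mid Z=z)$. Convention on conditioning: since $Z$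 is independent of $U$, for a bounded measurable function $F$ the conditional expectation $E(F(Z,U)\mid Z=z)$ is taken, for every $z\in\mathbf{Z}$, to be $E(F(z,U))$; in particular $E(X_j\mid Z=z)=E(g_j(z,U))$ and $E(Y\mid Z=z)=E(f(g(z,U),U))$. *)

(* Defs.v *)
From HB Require Import structures.
From mathcomp Require Import all_boot all_order all_algebra.
From mathcomp Require Import all_classical all_reals all_analysis.

Set Implicit Arguments.
Unset Strict Implicit.
Unset Printing Implicit Defensive.

Import Order.TTheory GRing.Theory Num.Theory.
Import numFieldNormedType.Exports.

Local Open Scope classical_set_scope.
Local Open Scope ring_scope.

(* Points of R^n taken as values by random vectors are n-tuples, because the
   library equips [n.-tuple R] with the product (Borel) sigma-algebra. The
   vectors and matrices of the linear system are column vectors and matrices. *)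

Definition bounded_nondegenerate (R : realType) (I : interval R) : Prop :=
  exists (bl br : bool) (l r : R),
    l < r /\ I = Interval (BSide bl l) (BSide br r).

Definition rectangle (R : realType) (n : nat) (I : 'I_n -> interval R) :
    set (n.-tuple R) :=
  [set x | forall j, tnth x j \in I j].

(* x + t e_j *)
Definition shift_coord (R : realType) (n : nat) (x : n.-tuple R) (j : 'I_n)
    (t : R) : n.-tuple R :=
  [tuple tnth x l + (if l == j then t else 0) | l < n].

(* The limit of the difference quotient is taken over the t != 0 such that
   x + t e_j stays in A. On a nondegenerate rectangle this is the ordinary
   partial derivative when x_j is interior to its interval, and the one-sided
   one when x_j is an endpoint of it. *)
Definition partial_quotient (R : realType) (n : nat) (A : set (n.-tuple R))
    (j : 'I_n) (F : n.-tuple R -> R) (x : n.-tuple R) : set_system R :=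
  (fun t : R => (F (shift_coord x j t) - F x) / t)
    @ within [set t | A (shift_coord x j t)] (0 : R)^'.

Definition has_partial (R : realType) (n : nat) (A : set (n.-tuple R))
    (j : 'I_n) (F : n.-tuple R -> R) (x : n.-tuple R) : Prop :=
  cvg (partial_quotient A j F x).

Definition partial (R : realType) (n : nat) (A : set (n.-tuple R))
    (j : 'I_n) (F : n.-tuple R -> R) (x : n.-tuple R) : R :=
  lim (partial_quotient A j F x).

(* F(., u) has first and second order partial derivatives on A, and F and these
   derivatives are bounded on A by a constant that does not depend on u. *)
Definition smooth_on (R : realType) (n : nat) (T : Type)
    (A : set (n.-tuple R)) (F : n.-tuple R -> T -> R) : Prop :=
  [/\ forall (x : n.-tuple R) (u : T) (j : 'I_n), A x ->
        has_partial A j (F^~ u) x,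
      forall (x : n.-tuple R) (u : T) (j k : 'I_n), A x ->
        has_partial A k (partial A j (F^~ u)) x
    & exists M : R, forall (x : n.-tuple R) (u : T), A x ->
        [/\ `|F x u| <= M,
            forall j : 'I_n, `|partial A j (F^~ u) x| <= M
          & forall j k : 'I_n,
              `|partial A k (partial A j (F^~ u)) x| <= M]].

Definition independent_RVs (d d1 d2 : measure_display)
    (Omega : measurableType d) (T1 : measurableType d1)
    (T2 : measurableType d2) (R : realType) (P : probability Omega R)
    (V : Omega -> T1) (W : Omega -> T2) : Prop :=
  forall (A : set T1) (B : set T2), measurable A -> measurable B ->
    P ((V @^-1` A) `&` (W @^-1` B)) = (P (V @^-1` A) * P (W @^-1` B))%E.

(* E(F(Z, U) | Z = z). As Z and U are independent, the version
   z |-> E(F(z, U)) is taken, which is determined at every z. *)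
Definition cexp (d d' : measure_display) (Omega : measurableType d)
    (T : measurableType d') (R : realType) (P : probability Omega R)
    (U : Omega -> T) (m : nat) (F : m.-tuple R -> T -> R)
    (z : m.-tuple R) : R :=
  fine 'E_P[fun w => F z (U w)].

Definition cuncorrelated (d d' : measure_display) (Omega : measurableType d)
    (T : measurableType d') (R : realType) (P : probability Omega R)
    (U : Omega -> T) (m : nat) (B C : m.-tuple R -> T -> R)
    (z : m.-tuple R) : Prop :=
  cexp P U (fun z u => B z u * C z u) z = cexp P U B z * cexp P U C z.

Section model.
Variables (d d' : measure_display) (Omega : measurableType d)
  (T : measurableType d') (R : realType) (P : probability Omega R).
Variables (n m : nat) (XX : set (n.-tuple R)) (ZZ : set (m.-tuple R)).
Variables (f : n.-tuple R -> T -> R) (g : m.-tuple R -> T -> n.-tuple R).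
Variable U : Omega -> T.

(* Y, X_j, dY/dX_j = h_j(X, U) and dX_j/dZ_i = k_ij(Z, U) as functions of
   (Z, U), obtained by substituting X = g(Z, U). *)
Definition Y_of (z : m.-tuple R) (u : T) : R := f (g z u) u.

Definition X_of (j : 'I_n) (z : m.-tuple R) (u : T) : R := tnth (g z u) j.

Definition dYdX (j : 'I_n) (z : m.-tuple R) (u : T) : R :=
  partial XX j (f^~ u) (g z u).

Definition dXdZ (i : 'I_m) (j : 'I_n) (z : m.-tuple R) (u : T) : R :=
  partial ZZ i ((X_of j)^~ u) z.

Definition a_mx (z : m.-tuple R) : 'M[R]_(m, n) :=
  \matrix_(i < m, j < n) partial ZZ i (cexp P U (X_of j)) z.

Definition b_vec (z : m.-tuple R) : 'cV[R]_m :=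
  \col_(i < m) partial ZZ i (cexp P U Y_of) z.

Definition phi_vec (z : m.-tuple R) : 'cV[R]_n :=
  \col_(j < n) cexp P U (dYdX j) z.

End model.

(* Main.v *)
(* Bounded second derivatives make every first-order expansion uniform: the
   increment of F along t e_i differs from t times the partial derivative by at
   most K t^2, with K independent of u, and by composition the same holds for
   z |-> f(g(z, u), u) with derivative sum_j h_j k_ij. Integrating these bounds
   over u differentiates under the expectation, so a_ij = E(k_ij) and
   b_i = sum_j E(h_j k_ij), which equals sum_j a_ij phi_j by uncorrelatedness.
   Uniqueness holds because a has full column rank. *)

Require Import Defs.
From HB Require Import structures.
From mathcomp Require Import all_boot all_order all_algebra.
From mathcomp Require Import all_classical all_reals all_analysis.
From mathcomp Require Import measurable_realfun.
From mathcomp Require Import ring lra.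

Set Implicit Arguments.
Unset Strict Implicit.
Unset Printing Implicit Defensive.

Import Order.TTheory GRing.Theory Num.Theory.
Import numFieldNormedType.Exports.

Local Open Scope classical_set_scope.
Local Open Scope ring_scope.

(** * Mean value and first-order estimates on a rectangle *)

Section increments.
Context {R : realType}.

(** The hypothesis is differentiability on the closed unit interval, one-sided at 0 and 1, so
    nothing is asked of [phi] outside it. This suits functions controlled only on a rectangle. *)
Lemma mean_value01 (phi dphi : R -> R) :
  (forall c, 0 <= c <= 1 -> forall e, 0 < e -> exists2 r, 0 < r &
     forall h, `|h| < r -> 0 <= c + h <= 1 ->
       `|phi (c + h) - phi c - dphi c * h| <= e * `|h|) ->
  exists2 c, 0 <= c <= 1 & phi 1 - phi 0 = dphi c.
Proof.
move=> D.
have [| | c] := @MVT R phi dphi 0 1 ltr01.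
- move=> c; rewrite in_itv/= => /andP[c0 c1].
  have cvg_c : (fun h : R => h^-1 *: ((phi \o shift c) (h *: 1) - phi c))
      @ 0^' --> dphi c.
    apply/cvgrPdist_le => e e0.
    have [|r r0 Dr] := D c _ e e0; first by rewrite !ltW.
    rewrite /dnbhs near_withinE.
    apply/nbhs_ballP; exists (Num.min r (Num.min c (1 - c))).
      by rewrite /= !lt_min r0 c0 subr_gt0.
    move=> h; rewrite /ball/= sub0r normrN !lt_min => /and3P[hr hc hc1] h0.
    have := Dr h hr.
    have ch01 : 0 <= c + h <= 1.
      move: hc hc1; rewrite !ltr_norml => /andP[? ?] /andP[? ?].
      by apply/andP; split; lra.
    move=> /(_ ch01).
    rewrite /= -ler_pdivrMr ?normr_gt0// distrC -normfV -normrM.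
    rewrite [h *: 1]mulr1 (addrC h c).
    by rewrite mulrC mulrBr [dphi c * h]mulrC mulKf.
  apply: DeriveDef; first by apply/cvg_ex; exists (dphi c).
  exact/cvg_lim.
- apply/subspace_continuousP => c /=; rewrite in_itv/= => c01.
  apply/cvgrPdist_le => e e0.
  (* Tolerance 1 already gives [|phi y - phi c| <= K * |y - c|] near [c], hence continuity at
     [c]. *)
  have [r r0 Dr] := D c c01 1 ltr01.
  rewrite near_withinE; apply/nbhs_ballP.
  pose K := 1 + `|dphi c|.
  have K0 : 0 < K by rewrite ltr_wpDr.
  exists (Num.min r (e / K)); first by rewrite /= lt_min r0 divr_gt0.
  move=> y; rewrite /ball/= distrC lt_min => /andP[yr ye].
  rewrite in_itv/= => y01.
  have := Dr (y - c) yr; rewrite addrC subrK => /(_ y01) H.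
  rewrite distrC -(subrK (dphi c * (y - c)) (phi y - phi c)).
  rewrite (le_trans (ler_normD _ _))// normrM.
  apply: (le_trans (lerD H (lexx _))).
  by rewrite -mulrDl -/K mulrC -ler_pdivlMr// ltW.
- rewrite in_itv/= subr0 mulr1 => /andP[c0 c1] E.
  by exists c => //; rewrite !ltW.
Qed.

Section coordinates.
Context {n : nat}.
Implicit Types (x y : n.-tuple R) (A : set (n.-tuple R)) (j : 'I_n).

Lemma tnth_shift_coord x j (t : R) l :
  tnth (shift_coord x j t) l = tnth x l + (if l == j then t else 0).
Proof. by rewrite tnth_mktuple. Qed.

Lemma shift_coord0 x j : shift_coord x j 0 = x.
Proof. by apply: eq_from_tnth => l; rewrite tnth_shift_coord if_same addr0. Qed.

Lemma shift_coordD x j (s t : R) :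
  shift_coord (shift_coord x j s) j t = shift_coord x j (s + t).
Proof.
apply: eq_from_tnth => l; rewrite !tnth_shift_coord.
by case: eqP => _; rewrite ?addr0// addrA.
Qed.

(** Multiplying through by [|t|] removes the division; the case [t = 0], excluded from the punctured
    filter, then holds trivially. *)
Lemma partial_quotient_cvgP A j (F : n.-tuple R -> R) x (l : R) :
  partial_quotient A j F x --> l <->
  forall e, 0 < e -> exists2 r, 0 < r & forall t, `|t| < r ->
    A (shift_coord x j t) ->
    `|F (shift_coord x j t) - F x - l * t| <= e * `|t|.
Proof.
rewrite /partial_quotient; split.
- move=> /cvgrPdist_le H e e0; have := H e e0.
  rewrite /dnbhs !near_withinE => /nbhs_ballP[r/= r0 Hr].
  exists r => // t tr At.
  have [->|t0] := eqVneq t 0.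
    by rewrite shift_coord0 subrr mulr0 subrr normr0 mulr0.
  have := Hr t; rewrite /ball/= sub0r normrN => /(_ tr t0 At).
  rewrite -(ler_pM2r (_ : 0 < `|t|)) ?normr_gt0// -normrM mulrBl divfK//.
  by rewrite distrC.
- move=> H; apply/cvgrPdist_le => e e0; have [r r0 Hr] := H e e0.
  rewrite /dnbhs !near_withinE; apply/nbhs_ballP; exists r => //= t.
  rewrite /ball/= sub0r normrN => tr t0 At.
  rewrite -(ler_pM2r (_ : 0 < `|t|)) ?normr_gt0// -normrM mulrBl divfK//.
  by rewrite distrC; exact: Hr.
Qed.

Section rectangles.
Variable I : 'I_n -> interval R.
Local Notation A := (rectangle I).

Lemma rectangle_segment x j (t c : R) : A x -> A (shift_coord x j t) ->
  0 <= c <= 1 -> A (shift_coord x j (c * t)).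
Proof.
move=> Ax Axt /andP[c0 c1] l; have := Axt l; have := Ax l.
rewrite !tnth_shift_coord; case: eqP => _; last by rewrite addr0.
set a := tnth x l => Ia Iat.
have [t0|t0] := leP 0 t.
- by apply: (interval_is_interval Ia Iat); apply/andP; split; nra.
- by apply: (interval_is_interval Iat Ia); apply/andP; split; nra.
Qed.

(** The mean value theorem is applied to [c |-> F (x + c t e_j)], whose derivative is the partial
    derivative times [t]; convexity of the intervals keeps the segment inside the rectangle. *)
Lemma partial_mean_value j (F : n.-tuple R -> R) x (t : R) :
  (forall y, A y -> has_partial A j F y) -> A x -> A (shift_coord x j t) ->
  exists2 c, 0 <= c <= 1 &
    F (shift_coord x j t) - F x = partial A j F (shift_coord x j (c * t)) * t.
Proof.
move=> dF Ax Axt.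
have [|c c01] := @mean_value01 (fun c => F (shift_coord x j (c * t)))
    (fun c => partial A j F (shift_coord x j (c * t)) * t).
  (* Adding 1 keeps [K] positive when [t = 0]. *)
  move=> c c01 e e0; pose K := `|t| + 1.
  have K0 : 0 < K by rewrite ltr_wpDl.
  have tK : `|t| <= K by rewrite lerDl.
  have /partial_quotient_cvgP/(_ (e / K)) := dF _ (rectangle_segment Ax Axt c01).
  case=> [|r r0 Hr]; first by rewrite divr_gt0.
  exists (r / K) => [|h hr ch01]; first by rewrite divr_gt0.
  have := Hr (h * t).
  rewrite shift_coordD -mulrDl.
  have htr : `|h * t| < r.
    rewrite normrM; apply: le_lt_trans (_ : `|h| * K < _).
      exact: ler_wpM2l.
    by rewrite -ltr_pdivlMr.
  move=> /(_ htr (rectangle_segment Ax Axt ch01)).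
  rewrite [h * t]mulrC mulrA => /le_trans; apply.
  rewrite normrM mulrA ler_wpM2r// mulrAC -mulrA ler_piMr ?(ltW e0)//.
  by rewrite ler_pdivrMr// mul1r.
by rewrite mul1r mul0r shift_coord0 => E; exists c.
Qed.

Lemma shift_lipschitz j (F : n.-tuple R -> R) (M : R) x (t : R) :
  (forall y, A y -> has_partial A j F y) ->
  (forall y, A y -> `|partial A j F y| <= M) ->
  A x -> A (shift_coord x j t) ->
  `|F (shift_coord x j t) - F x| <= M * `|t|.
Proof.
move=> dF bF Ax Axt; have [c c01 ->] := partial_mean_value dF Ax Axt.
by rewrite normrM ler_wpM2r//; apply: bF; exact: rectangle_segment.
Qed.

(** One mean value step gives the partial derivative at an intermediate point; the Lipschitz bound
    on that derivative moves it back to [x] at cost [M * |t|]. *)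
Lemma shift_taylor j (F : n.-tuple R -> R) (M : R) x (t : R) :
  (forall y, A y -> has_partial A j F y) ->
  (forall y, A y -> has_partial A j (partial A j F) y) ->
  (forall y, A y -> `|partial A j (partial A j F) y| <= M) ->
  A x -> A (shift_coord x j t) ->
  `|F (shift_coord x j t) - F x - partial A j F x * t| <= M * `|t| ^+ 2.
Proof.
move=> dF ddF bF Ax Axt; have [c c01 ->] := partial_mean_value dF Ax Axt.
rewrite -mulrBl normrM expr2 mulrA ler_wpM2r//.
apply: le_trans (shift_lipschitz ddF bF Ax (rectangle_segment Ax Axt c01)) _.
have M0 : 0 <= M by apply: le_trans (bF _ Ax).
rewrite ler_wpM2l// normrM ler_piMl//.
by case/andP: c01 => c0 c1; rewrite ger0_norm.
Qed.

(* Passes from x (k = 0) to y (k = n) by replacing one coordinate at a time. *)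
Definition splice x y (k : nat) : n.-tuple R :=
  [tuple if (l < k)%N then tnth y l else tnth x l | l < n].

Lemma splice0 x y : splice x y 0 = x.
Proof. by apply: eq_from_tnth => l; rewrite tnth_mktuple. Qed.

Lemma splice_full x y : splice x y n = y.
Proof. by apply: eq_from_tnth => l; rewrite tnth_mktuple ltn_ord. Qed.

Lemma spliceS x y (k : 'I_n) :
  splice x y k.+1 = shift_coord (splice x y k) k (tnth y k - tnth x k).
Proof.
apply: eq_from_tnth => l; rewrite tnth_shift_coord !tnth_mktuple ltnS.
have [->|lk] := eqVneq l k; first by rewrite leqnn ltnn addrC subrK.
by rewrite addr0 leq_eqVlt (inj_eq val_inj) (negbTE lk).
Qed.

Lemma rectangle_splice x y k : A x -> A y -> A (splice x y k).
Proof. by move=> Ax Ay l; rewrite tnth_mktuple; case: ifP. Qed.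

Lemma splice_dist x y k (e : R) :
  (forall l, `|tnth y l - tnth x l| <= e) ->
  forall l, `|tnth (splice x y k) l - tnth x l| <= e.
Proof.
move=> H l; rewrite tnth_mktuple; case: ifP => // _.
by rewrite subrr normr0; apply: le_trans (H l).
Qed.

Lemma splice_telescope (F : n.-tuple R -> R) x y :
  F y - F x = \sum_(k < n) (F (splice x y k.+1) - F (splice x y k)).
Proof.
rewrite -(big_mkord xpredT (fun k => F (splice x y k.+1) - F (splice x y k))).
by rewrite telescope_sumr// splice_full splice0.
Qed.

(** Consecutive splices differ in one coordinate and stay in the rectangle, so the increment
    telescopes into [n] one-coordinate steps, each at most [M * e]. *)
Lemma rectangle_lipschitz (F : n.-tuple R -> R) (M e : R) x y :
  (forall j z, A z -> has_partial A j F z) ->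
  (forall j z, A z -> `|partial A j F z| <= M) ->
  A x -> A y -> (forall l, `|tnth y l - tnth x l| <= e) ->
  `|F y - F x| <= n%:R * (M * e).
Proof.
move=> dF bF Ax Ay xye; rewrite (splice_telescope F x y).
rewrite mulr_natl -[X in _ *+ X]card_ord -sumr_const.
apply: le_trans (ler_norm_sum _ _ _) _; apply: ler_sum => k _.
have As i : A (splice x y i) by exact: rectangle_splice.
have := As k.+1; rewrite spliceS => Ask.
apply: le_trans (shift_lipschitz (dF k) (bF k) (As k) Ask) _.
by rewrite ler_wpM2l//; apply: le_trans (bF k _ Ax).
Qed.

(** Each telescoped step is expanded at its own splice point with error [M * e^2]. Moving that
    partial derivative back to [x] costs [n * (M * e)], through the mixed second derivatives, times
    a step of size at most [e]; hence the factor [n + 1]. *)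
Lemma rectangle_taylor (F : n.-tuple R -> R) (M e : R) x y :
  (forall j z, A z -> has_partial A j F z) ->
  (forall j k z, A z -> has_partial A k (partial A j F) z) ->
  (forall j k z, A z -> `|partial A k (partial A j F) z| <= M) ->
  A x -> A y -> (forall l, `|tnth y l - tnth x l| <= e) ->
  `|F y - F x - \sum_j partial A j F x * (tnth y j - tnth x j)| <=
    n%:R * (n.+1%:R * M * e ^+ 2).
Proof.
move=> dF ddF bF Ax Ay xye; rewrite (splice_telescope F x y) -sumrB.
rewrite mulr_natl -[X in _ *+ X]card_ord -sumr_const.
apply: le_trans (ler_norm_sum _ _ _) _; apply: ler_sum => k _.
have As i : A (splice x y i) by exact: rectangle_splice.
have := As k.+1; rewrite spliceS => Ask.
set s := splice x y k; set t := tnth y k - tnth x k.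
have M0 : 0 <= M by apply: le_trans (bF k k _ Ax).
have e0 : 0 <= e by apply: le_trans (xye k).
have := shift_taylor (dF k) (ddF k k) (bF k k) (As k) Ask.
have := rectangle_lipschitz (ddF k) (bF k) Ax (As k) (splice_dist k xye).
rewrite -/s -/t => lip tay.
rewrite -(subrK (partial A k F s * t) (F _ - F _)) -[X in `|X|]addrA -mulrBl.
apply: le_trans (ler_normD _ _) _; rewrite normrM.
have -> : n.+1%:R * M * e ^+ 2 = M * e ^+ 2 + n%:R * (M * e) * e.
  by rewrite -natr1; ring.
apply: lerD.
  apply: le_trans tay _; rewrite ler_wpM2l// lerXn2r ?nnegrE//.
  exact: xye.
by apply: ler_pM => //; exact: xye.
Qed.

End rectangles.
End coordinates.
End increments.

(** * Uniqueness and measurability of partial derivatives *)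

Section nondegenerate_rectangles.
Context {R : realType} {n : nat} (I : 'I_n -> interval R).
Hypothesis I_bnd : forall j, bounded_nondegenerate (I j).
Local Notation A := (rectangle I).

(* Moving away from the nearer endpoint keeps x in the rectangle; p is the
   midpoint of I j, so the direction is a measurable function of x. *)
Lemma inward_step (j : 'I_n) : exists p c : R, 0 < c /\
  forall x s, A x -> 0 <= s <= c ->
    A (shift_coord x j (if tnth x j < p then s else - s)).
Proof.
have [bl [br [l [r [lr Ij]]]]] := I_bnd j.
(* A step of at most a quarter of the length, away from the nearer endpoint, cannot reach the other
   endpoint. *)
exists ((l + r) / 2), ((r - l) / 4); split; first by lra.
move=> x s Ax /andP[s0 sc] k; have := Ax k.
rewrite tnth_shift_coord; case: eqP => [->|_]; last by rewrite addr0.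
rewrite Ij; have [xp|xp] := ltP (tnth x j) ((l + r) / 2);
  rewrite !in_itv; move: bl br {Ij} => [] [] /=; lra.
Qed.

(** Turns the filter limit into a limit along a sequence of nonzero admissible increments, to which
    uniqueness of real limits and measurability of pointwise limits apply. *)
Lemma partial_quotient_seq (F : n.-tuple R -> R) j x (l : R) (t : nat -> R) :
  partial_quotient A j F x --> l -> t @ \oo --> (0 : R) ->
  (forall k, t k != 0) -> (forall k, A (shift_coord x j (t k))) ->
  (fun k => (F (shift_coord x j (t k)) - F x) / t k) @ \oo --> l.
Proof.
move=> Fl t0 tn0 At.
pose q s := (F (shift_coord x j s) - F x) / s.
apply: (@cvg_comp _ _ _ t q _ _ _ _ Fl) => P.
rewrite /within/= /dnbhs /within /= => /t0; apply: (@filterS _ (nbhs \oo)) => k /= H.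
exact: H (tn0 k) (At k).
Qed.

Lemma inward_step_cvg (c : R) (b : bool) :
  (fun k : nat => if b then c * k.+1%:R^-1 else - (c * k.+1%:R^-1))
    @ \oo --> (0 : R).
Proof.
have h : (fun k : nat => c * k.+1%:R^-1) @ \oo --> (0 : R).
  by rewrite -(mulr0 c); apply: cvgMr; exact: cvg_harmonic.
by case: b => //; rewrite -oppr0; exact: cvgN.
Qed.

Lemma inward_step_le (c : R) (k : nat) : 0 < c -> 0 < c * k.+1%:R^-1 <= c.
Proof.
move=> c0; rewrite mulr_gt0 ?invr_gt0 ?ltr0n//= ler_piMr ?(ltW c0)//.
by rewrite invf_le1// ler1n.
Qed.

(** Nondegeneracy matters here: the inward steps form a null sequence of nonzero admissible
    increments, along which [l] and the value chosen by [lim] are limits of the same real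
    sequence. *)
Lemma partial_unique (F : n.-tuple R -> R) j x (l : R) :
  A x -> partial_quotient A j F x --> l -> partial A j F x = l.
Proof.
move=> Ax Fl; have [p [c [c0 step]]] := inward_step j.
pose t k := if tnth x j < p then c * k.+1%:R^-1 else - (c * k.+1%:R^-1) : R.
have t0 k : t k != 0.
  have /andP[ck _] := inward_step_le k c0.
  by rewrite /t; case: ifP => _; rewrite ?oppr_eq0 gt_eqF.
have At k : A (shift_coord x j (t k)).
  by apply: step => //; have /andP[/ltW -> ->] := inward_step_le k c0.
have tcvg := inward_step_cvg c (tnth x j < p).
have dF : partial_quotient A j F x --> partial A j F x by exact: (cvgP l).
apply: (cvg_unique _ (partial_quotient_seq dF tcvg t0 At)).
- exact: norm_hausdorff.
- exact: partial_quotient_seq Fl tcvg t0 At.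
Qed.

Lemma measurable_rectangle : measurable A.
Proof.
rewrite (_ : A = \bigcap_(j in [set: 'I_n]) ((@tnth n R)^~ j @^-1` [set` I j])).
  apply: fin_bigcap_measurable => // j _.
  rewrite -[X in measurable X]setTI.
  by apply: measurable_tnth => //; exact: measurable_itv.
by apply/seteqP; split => x /= H j; [move=> _|]; exact: H.
Qed.

Context {d : measure_display} {T : measurableType d}.
Implicit Types (F : n.-tuple R -> T -> R) (V : T -> n.-tuple R).

Lemma measurable_rectangle_comp {d'} {S : measurableType d'}
    (F : n.-tuple R -> T -> S) V :
  measurable_fun (A `*` [set: T]) (fun p : n.-tuple R * T => F p.1 p.2) ->
  measurable_fun [set: T] V -> (forall u, A (V u)) ->
  measurable_fun [set: T] (fun u => F (V u) u).
Proof.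
move=> mF mV AV.
apply: (@measurable_comp _ _ _ _ _ _ (A `*` [set: T])
  (fun p : n.-tuple R * T => F p.1 p.2) setT (fun u => (V u, u))) => //.
- by apply: measurableX => //; exact: measurable_rectangle.
- by move=> _ [u _ <-]; split=> /=.
- exact: (@measurable_fun_pair _ _ _ T _ T V id mV (@measurable_id _ _ setT)).
Qed.

Lemma measurable_shift_coord V (t : T -> R) j :
  measurable_fun [set: T] V -> measurable_fun [set: T] t ->
  measurable_fun [set: T] (fun u => shift_coord (V u) j (t u)).
Proof.
move=> /measurable_fun_tnthP mV mt; apply/measurable_fun_tnthP => l.
rewrite [X in measurable_fun _ X](_ : _ =
    fun u => tnth (V u) l + (if l == j then t u else 0)); last first.
  by apply/funext => u; rewrite /= tnth_shift_coord.
apply: measurable_funD; first exact: mV.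
by case: (l == j).
Qed.

(** The partial derivative is a pointwise limit of measurable difference quotients along inward
    steps. The sign of a step depends on [u] only through the measurable test [tnth (V u) j < p]. *)
Lemma measurable_partial F V j :
  measurable_fun (A `*` [set: T]) (fun p : n.-tuple R * T => F p.1 p.2) ->
  (forall u x, A x -> has_partial A j (F^~ u) x) ->
  measurable_fun [set: T] V -> (forall u, A (V u)) ->
  measurable_fun [set: T] (fun u => partial A j (F^~ u) (V u)).
Proof.
move=> mF dF mV AV; have [p [c [c0 step]]] := inward_step j.
pose s k : R := c * k.+1%:R^-1.
pose t k u := if tnth (V u) j < p then s k else - s k.
have At k u : A (shift_coord (V u) j (t k u)).
  by apply: step => //; have /andP[/ltW -> ->] := inward_step_le k c0.
have mlt : measurable_fun [set: T] (fun u => tnth (V u) j < p).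
  by apply: measurable_fun_ltr => //; have/measurable_fun_tnthP := mV; apply.
have mt k : measurable_fun [set: T] (t k) by exact: measurable_fun_ifT.
(* [t k] takes only the values [s k] and [- s k], so its inverse is again a choice between two
   constants. *)
have mtV k : measurable_fun [set: T] (fun u => (t k u)^-1).
  rewrite [X in measurable_fun _ X](_ : _ =
      fun u => if tnth (V u) j < p then (s k)^-1 else (- s k)^-1).
    exact: measurable_fun_ifT.
  by apply/funext => u; rewrite /t; case: ifP.
apply: (@measurable_realfun.measurable_fun_cvg _ _ _ _
  (fun k u => (F (shift_coord (V u) j (t k u)) u - F (V u) u) / t k u)).
- move=> k; apply: measurable_funM => //; apply: measurable_funB.
  + apply: (measurable_rectangle_comp mF) => //.
    exact: measurable_shift_coord.
  + exact: measurable_rectangle_comp.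
- move=> u _.
  have H := @partial_quotient_seq (F^~ u) j (V u) _ (t^~ u) (dF u _ (AV u)).
  apply: H => //; first exact: inward_step_cvg.
  move=> k; have /andP[ck _] := inward_step_le k c0.
  by rewrite /t; case: ifP => _; rewrite ?oppr_eq0 gt_eqF.
Qed.

End nondegenerate_rectangles.

(** * Differentiation under the expectation *)

Section bounded_expectation.
Context {R : realType} {d d' : measure_display} {Omega : measurableType d}
  {T : measurableType d'} (P : probability Omega R) (U : {RV P >-> T}).

Lemma bounded_integrable (G : T -> R) (M : R) :
  measurable_fun [set: T] G -> (forall u, `|G u| <= M) ->
  P.-integrable [set: Omega] (EFin \o (fun w => G (U w))).
Proof.
move=> mG bG; apply: measurable_bounded_integrable => //.
- by apply: le_lt_trans (probability_le1 P measurableT) _; exact: ltry.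
- exact: (measurableT_comp mG).
- exists M; split; first exact: num_real.
  by move=> K MK w _ /=; apply: le_trans (bG _) (ltW MK).
Qed.

Lemma cexpE m (F : m.-tuple R -> T -> R) z :
  cexp P U F z = \int[P]_w F z (U w).
Proof. by rewrite /cexp unlock. Qed.

Lemma Rintegral_sum (k : nat) (h : 'I_k -> Omega -> R) :
  (forall i, P.-integrable [set: Omega] (EFin \o h i)) ->
  \int[P]_w (\sum_i h i w) = \sum_i \int[P]_w h i w.
Proof.
move=> ih; rewrite /Rintegral.
under eq_integral do rewrite -sumEFin.
rewrite integral_sum => [||i]; [|exact: measurableT|exact: ih].
by rewrite sum_fine// => i _; apply: integrable_fin_num; [exact: measurableT|exact: ih].
Qed.

Lemma normr_Rintegral_le (Q : Omega -> R) (c : R) :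
  P.-integrable [set: Omega] (EFin \o Q) -> (forall w, `|Q w| <= c) ->
  `|\int[P]_w Q w| <= c.
Proof.
move=> iQ Qc; apply: le_trans (le_normr_Rintegral _ iQ) _ => //.
have <- : \int[P]_(_ in [set: Omega]) c = c.
  rewrite Rintegral_cst// -[RHS]mulr1; congr (_ * _).
  exact: (congr1 fine (probability_setT P)).
apply: le_Rintegral => //; first exact: integrable_norm.
exact: finite_measure_integrable_cst.
Qed.

(** The remainder bound has one constant [K] for all [u], so integrating it against a probability
    measure gives the same bound for the expectations, and [K * t^2] is [o(t)]. *)
Lemma cexp_partial_quotient m (I : 'I_m -> interval R)
    (F : m.-tuple R -> T -> R) (D : T -> R) (z : m.-tuple R) (i : 'I_m)
    (M K : R) :
  (forall y, rectangle I y -> measurable_fun [set: T] (F y)) ->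
  (forall y u, rectangle I y -> `|F y u| <= M) ->
  P.-integrable [set: Omega] (EFin \o (fun w => D (U w))) ->
  rectangle I z ->
  (forall u t, rectangle I (shift_coord z i t) ->
     `|F (shift_coord z i t) u - F z u - D u * t| <= K * `|t| ^+ 2) ->
  partial_quotient (rectangle I) i (cexp P U F) z --> \int[P]_w D (U w).
Proof.
move=> mF bF iD Az H; apply/partial_quotient_cvgP => e e0.
(* [L] is positive whatever the sign of [K], and [|t| < e / L] forces [K * |t|^2 <= e * |t|]. *)
pose L := `|K| + 1; have L0 : 0 < L by rewrite ltr_wpDl.
exists (e / L) => [|t tr At]; first by rewrite divr_gt0.
have iF y : rectangle I y ->
    P.-integrable [set: Omega] (EFin \o (fun w => F y (U w))).
  by move=> Ay; apply: bounded_integrable (mF _ Ay) (fun u => bF y u Ay).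
have iB := integrableB measurableT (iF _ At) (iF _ Az).
have iDt := integrableZr measurableT t iD.
rewrite !cexpE -RintegralZr// -RintegralB//; try exact: iF.
rewrite -RintegralB//.
apply: (@le_trans _ _ (K * `|t| ^+ 2)).
  apply: normr_Rintegral_le => [|w]; last exact: H.
  exact: (integrableB measurableT iB iDt).
rewrite expr2 mulrA ler_wpM2r//.
apply: (@le_trans _ _ (L * `|t|)).
  by rewrite ler_wpM2r// (le_trans (ler_norm _))// lerDl.
by rewrite mulrC -ler_pdivlMr// ltW.
Qed.

End bounded_expectation.

(** A chain rule with quadratic remainder. The coordinates of [G] move by at most [N * |t|], so
    expanding [F] gives the first term of the constant; replacing each increment of [G] by its
    linear part gives the second. *)
Lemma composite_taylor {R : realType} {n m : nat} (I : 'I_n -> interval R)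
    (J : 'I_m -> interval R) (F : n.-tuple R -> R)
    (G : m.-tuple R -> n.-tuple R) (M N : R) z (i : 'I_m) (t : R) :
  (forall j x, rectangle I x -> has_partial (rectangle I) j F x) ->
  (forall j k x, rectangle I x ->
     has_partial (rectangle I) k (partial (rectangle I) j F) x) ->
  (forall j x, rectangle I x -> `|partial (rectangle I) j F x| <= M) ->
  (forall j k x, rectangle I x ->
     `|partial (rectangle I) k (partial (rectangle I) j F) x| <= M) ->
  let Gj j y := tnth (G y) j in
  let dG j := partial (rectangle J) i (Gj j) in
  (forall j y, rectangle J y -> has_partial (rectangle J) i (Gj j) y) ->
  (forall j y, rectangle J y -> has_partial (rectangle J) i (dG j) y) ->
  (forall j y, rectangle J y -> `|dG j y| <= N) ->
  (forall j y, rectangle J y -> `|partial (rectangle J) i (dG j) y| <= N) ->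
  (forall y, rectangle J y -> rectangle I (G y)) ->
  rectangle J z -> rectangle J (shift_coord z i t) ->
  `|F (G (shift_coord z i t)) - F (G z) -
      (\sum_j partial (rectangle I) j F (G z) * dG j z) * t| <=
    (n%:R * (n.+1%:R * M * N ^+ 2) + n%:R * (M * N)) * `|t| ^+ 2.
Proof.
move=> dF ddF bF bddF Gj dG dGj ddG bG bddG GI Jz Jzt.
have lip j : `|tnth (G (shift_coord z i t)) j - tnth (G z) j| <= N * `|t|.
  exact: shift_lipschitz (dGj j) (bG j) Jz Jzt.
have tayF := rectangle_taylor dF ddF bddF (GI _ Jz) (GI _ Jzt) lip.
have tayG j := shift_taylor (dGj j) (ddG j) (bddG j) Jz Jzt.
(* [s1] is the linear form in the actual increments of [G]; it separates the error of linearizing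
   [F] from that of linearizing [G]. *)
move: tayF; set a := F _; set b := F _; set s1 := \sum_j _ => tayF.
rewrite -(subrK s1 (a - b)) -[X in `|X|]addrA.
apply: le_trans (ler_normD _ _) _; rewrite mulrDl; apply: lerD.
  by apply: le_trans tayF _; rewrite exprMn !mulrA.
rewrite mulr_suml -sumrB -mulrA mulr_natl -[X in _ *+ X]card_ord -sumr_const.
apply: le_trans (ler_norm_sum _ _ _) _; apply: ler_sum => j _.
rewrite -mulrA -mulrBr normrM -mulrA.
by apply: ler_pM => //; [exact/bF/GI|exact: tayG].
Qed.

(** * The linear system for the conditional mean gradient *)

Theorem theorem3 (R : realType) (d d' : measure_display)
  (Omega : measurableType d) (T : measurableType d')
  (P : probability Omega R)
  (n m : nat) (n_gt0 : (0 < n)%N) (m_gt0 : (0 < m)%N)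
  (IX : 'I_n -> interval R) (IZ : 'I_m -> interval R)
  (IX_bnd : forall j : 'I_n, bounded_nondegenerate (IX j))
  (IZ_bnd : forall i : 'I_m, bounded_nondegenerate (IZ i))
  (f : n.-tuple R -> T -> R) (g : m.-tuple R -> T -> n.-tuple R)
  (f_meas : measurable_fun (rectangle IX `*` [set: T])
     (fun p : n.-tuple R * T => f p.1 p.2))
  (g_meas : measurable_fun (rectangle IZ `*` [set: T])
     (fun p : m.-tuple R * T => g p.1 p.2))
  (g_in : forall (z : m.-tuple R) (u : T),
     rectangle IZ z -> rectangle IX (g z u))
  (f_smooth : smooth_on (rectangle IX) f)
  (g_smooth : forall j : 'I_n, smooth_on (rectangle IZ) (X_of g j))
  (U : {RV P >-> T}) (Z : {RV P >-> m.-tuple R})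
  (X : {RV P >-> n.-tuple R}) (Y : {RV P >-> R})
  (Z_in : forall w : Omega, rectangle IZ (Z w))
  (X_in : forall w : Omega, rectangle IX (X w))
  (X_eq : forall w : Omega, X w = g (Z w) (U w))
  (Y_eq : forall w : Omega, Y w = f (X w) (U w))
  (ZU_indep : independent_RVs P Z U)
  (uncorr : forall (i : 'I_m) (j : 'I_n) (z : m.-tuple R), rectangle IZ z ->
     cuncorrelated P U (dYdX (rectangle IX) f g j)
       (dXdZ (rectangle IZ) g i j) z)
  (rank_a : forall z : m.-tuple R, rectangle IZ z ->
     (n <= \rank (a_mx P (rectangle IZ) g U z))%N) :
  forall z : m.-tuple R, rectangle IZ z ->
    [/\ forall (i : 'I_m) (j : 'I_n),
          has_partial (rectangle IZ) i (cexp P U (X_of g j)) z,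
        forall i : 'I_m,
          has_partial (rectangle IZ) i (cexp P U (Y_of f g)) z,
        a_mx P (rectangle IZ) g U z *m phi_vec P (rectangle IX) f g U z
          = b_vec P (rectangle IZ) f g U z
      & forall v : 'cV[R]_n,
          a_mx P (rectangle IZ) g U z *m v = b_vec P (rectangle IZ) f g U z ->
          v = phi_vec P (rectangle IX) f g U z].
Proof.
move=> z Jz.
have [dF ddF [M bF]] := f_smooth.
have /choice[N0 bG0] : forall j : 'I_n, exists N : R, forall y u,
    rectangle IZ y -> [/\ `|X_of g j y u| <= N,
      forall i, `|partial (rectangle IZ) i ((X_of g j)^~ u) y| <= N
    & forall i k, `|partial (rectangle IZ) k
        (partial (rectangle IZ) i ((X_of g j)^~ u)) y| <= N].
  by move=> j; case: (g_smooth j).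
(* Smoothness gives one bound per component of [g]; the sum of their absolute values dominates all
   of them. *)
pose N := \sum_j `|N0 j|.
have N0N j : N0 j <= N.
  rewrite /N (bigD1 j)//= (le_trans (ler_norm _))// lerDl.
  exact: sumr_ge0.
pose h j u := dYdX (rectangle IX) f g j z u.
pose k i j u := dXdZ (rectangle IZ) g i j z u.
have mgz y : rectangle IZ y -> measurable_fun [set: T] (g y).
  move=> Jy; apply: (measurable_rectangle_comp (V := fun=> y) g_meas) => //.
have mh j : measurable_fun [set: T] (h j).
  apply: (measurable_partial IX_bnd f_meas) => //.
  - by move=> u x Ax; exact: dF.
  - exact: mgz.
  - by move=> u; exact: g_in.
have mX j : measurable_fun (rectangle IZ `*` [set: T])
    (fun p : m.-tuple R * T => X_of g j p.1 p.2).
  exact: (measurableT_comp (measurable_tnth j) g_meas).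
have mk i j : measurable_fun [set: T] (k i j).
  apply: (measurable_partial (V := fun=> z) IZ_bnd (mX j)) => //.
  by move=> u y Jy; case: (g_smooth j) => + _ _; apply.
have bh j u : `|h j u| <= M by have [_ + _] := bF _ u (g_in z u Jz); apply.
have bk i j u : `|k i j u| <= N.
  by have [_ /(_ i)/le_trans + _] := bG0 j z u Jz; apply.
have ik i j := bounded_integrable U (mk i j) (bk i j).
have ihk i j : P.-integrable [set: Omega]
    (EFin \o (fun w => h j (U w) * k i j (U w))).
  apply: (@bounded_integrable _ _ _ _ _ P U (fun u => h j u * k i j u) (M * N)).
    exact: measurable_funM.
  by move=> u; rewrite normrM ler_pM.
(* This identifies [a_ij] as [E(k_ij)]; [N] bounds both [g_j] and its second derivative, the latter
   being the remainder constant. *)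
have cvgX i j : partial_quotient (rectangle IZ) i (cexp P U (X_of g j)) z -->
    \int[P]_w k i j (U w).
  apply: (@cexp_partial_quotient _ _ _ _ _ P U _ IZ _ (k i j) _ _ N N) => //.
  - move=> y Jy; exact: (measurable_rectangle_comp (V := fun=> y) (mX j)).
  - by move=> y u Jy; have [/le_trans + _ _] := bG0 j y u Jy; apply.
  - move=> u t Jt; have [dG ddG _] := g_smooth j.
    apply: (shift_taylor (F := (X_of g j)^~ u)) => // y Jy.
    + exact: dG.
    + exact: ddG.
    + by have [_ _ /(_ i i)/le_trans] := bG0 j y u Jy; apply.
(* This identifies [b_i] as [E(sum_j h_j k_ij)], with the remainder constant of
   [composite_taylor]. *)
have cvgY i : partial_quotient (rectangle IZ) i (cexp P U (Y_of f g)) z -->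
    \int[P]_w (\sum_j h j (U w) * k i j (U w)).
  apply: (@cexp_partial_quotient _ _ _ _ _ P U _ IZ _
    (fun u => \sum_j h j u * k i j u) _ _ M
    (n%:R * (n.+1%:R * M * N ^+ 2) + n%:R * (M * N))) => //.
  - move=> y Jy; apply: (measurable_rectangle_comp f_meas (mgz y Jy)).
    by move=> u; exact: g_in.
  - by move=> y u Jy; have [] := bF _ u (g_in y u Jy).
  - apply: (@bounded_integrable _ _ _ _ _ P U
      (fun u => \sum_j h j u * k i j u) (\sum_(j < n) (M * N))).
      by apply: measurable_sum => j; exact: measurable_funM.
    move=> u; apply: le_trans (ler_norm_sum _ _ _) _; apply: ler_sum => j _.
    by rewrite normrM ler_pM.
  - move=> u t Jt.
    apply: (composite_taylor (F := f^~ u) (G := g^~ u) (I := IX)) => //.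
    + by move=> j x Ax; exact: dF.
    + by move=> j l x Ax; exact: ddF.
    + by move=> j x Ax; have [_ + _] := bF x u Ax; apply.
    + by move=> j l x Ax; have [_ _ +] := bF x u Ax; apply.
    + by move=> j y Jy; case: (g_smooth j) => + _ _; apply.
    + by move=> j y Jy; case: (g_smooth j) => _ + _; apply.
    + by move=> j y Jy; have [_ /(_ i)/le_trans + _] := bG0 j y u Jy; apply.
    + by move=> j y Jy; have [_ _ /(_ i i)/le_trans] := bG0 j y u Jy; apply.
    + by move=> y; exact: g_in.
have aphi : a_mx P (rectangle IZ) g U z *m phi_vec P (rectangle IX) f g U z
    = b_vec P (rectangle IZ) f g U z.
  apply/matrixP => i l; rewrite !mxE (partial_unique IZ_bnd Jz (cvgY i)).
  rewrite Rintegral_sum//; apply: eq_bigr => j _; rewrite !mxE.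
  rewrite (partial_unique IZ_bnd Jz (cvgX i j)).
  have := uncorr i j z Jz; rewrite /cuncorrelated !cexpE => ->.
  by rewrite mulrC.
split => //.
- by move=> i j; apply: cvgP; exact: cvgX.
- by move=> i; apply: cvgP; exact: cvgY.
(* Full column rank yields a left inverse [B] of [a], so [v = B a v = B b = B a phi = phi]. *)
move=> v av; have /row_fullP[B Ba] : row_full (a_mx P (rectangle IZ) g U z).
  by rewrite /row_full eqn_leq rank_leq_col rank_a.
by rewrite -[v]mul1mx -Ba -mulmxA av -aphi mulmxA Ba mul1mx.
Qed.
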